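(* Let $G=(X,Y,E)$ be a chordal bipartite graph in which every vertex has degree at most $3$. Then: (i) $G^2$ is hole-free; (ii) if $G$ is $H_4$-free, then $G^2$ is $A_4$-free.
   Context: A hole is a chordless (induced) cycle with at least 5 vertices. A bipartite graph is chordal bipartite if it contains no induced cycle $C_{2k}$ with $k\ge 3$. The square $G^2$ of $G$ has the same vertex set, with distinct $x,y$ adjacent iff their distance in $G$ is at most 2. $A_4$ is the graph on vertices $v_1,\dots,v_5$ where $v_1v_2v_3v_4$ induce a 4-cycle $C_4$ and $v_5$ is adjacent only to $v_3$. $H_4$ (the extended domino) is the graph on 8 vertices $a_1,\dots,a_6,b,c$ whose edges are those of the 6-cycle $a_1a_2a_3a_4a_5a_6a_1$, the chord $a_2a_5$, and the edges $a_4b$ and $bc$ (i.e. a domino with a pendant path of length 2 attached at a degree-2 vertex). A graph is $H$-free if it has no induced subgraph isomorphic to $H$. *)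

(* Defs.v *)
From HB Require Import structures.
From mathcomp Require Import all_boot.
Set Implicit Arguments.
Unset Strict Implicit.
Unset Printing Implicit Defensive.

Record sgraph := SGraph {
  svertex :> finType;
  sedge : rel svertex;
  sedge_sym : symmetric sedge;
  sedge_irrefl : irreflexive sedge
}.

Definition degree (G : sgraph) (x : G) : nat := #|[set y : G | sedge x y]|.

Definition induced_subgraph (H G : sgraph) : Prop :=
  exists2 f : H -> G, injective f & forall x y : H, sedge (f x) (f y) = sedge x y.

(* [is_free H G]: G is H-free. *)
Definition is_free (H G : sgraph) : Prop := ~ induced_subgraph H G.

Section Cycle.
Variable n : nat.

Definition cycle_rel : rel 'I_n :=
  fun i j => (i != j) && ((j == i.+1 %% n :> nat) || (i == j.+1 %% n :> nat)).

Lemma cycle_sym : symmetric cycle_rel.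
Proof. by move=> i j; rewrite /cycle_rel eq_sym orbC. Qed.

Lemma cycle_irrefl : irreflexive cycle_rel.
Proof. by move=> i; rewrite /cycle_rel eqxx. Qed.

(* The cycle C_n; only meaningful for 3 <= n. *)
Definition cycle_graph : sgraph := SGraph cycle_sym cycle_irrefl.
End Cycle.

Definition hole_free (G : sgraph) : Prop :=
  forall n, 5 <= n -> is_free (cycle_graph n) G.

Definition bipartition (G : sgraph) (X Y : {set G}) : Prop :=
  [/\ X :|: Y = [set: G], [disjoint X & Y] &
      forall x y : G, sedge x y ->
        (x \in X) && (y \in Y) || (x \in Y) && (y \in X)].

Definition chordal_bipartite (G : sgraph) (X Y : {set G}) : Prop :=
  bipartition X Y /\ forall k, 3 <= k -> is_free (cycle_graph (2 * k)) G.

(* The distance between x and y is at most n: some walk of length at most n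
   joins them. *)
Definition dist_le (G : sgraph) (n : nat) (x y : G) : bool :=
  [exists k : 'I_n.+1, exists p : k.-tuple G,
     path (@sedge G) x p && (last x p == y)].

Lemma dist_leP (G : sgraph) (n : nat) (x y : G) :
  reflect (exists p : seq G,
             [/\ size p <= n, path (@sedge G) x p & last x p = y])
          (dist_le n x y).
Proof.
apply: (iffP existsP) => [[k /existsP[p /andP[pp /eqP lp]]]|[p [sp pp lp]]].
  by exists p; split => //; rewrite size_tuple -ltnS.
have sp' : size p < n.+1 by [].
exists (Ordinal sp'); apply/existsP; exists (in_tuple p).
by rewrite pp lp /=.
Qed.

Lemma dist_le_sym (G : sgraph) n : symmetric (@dist_le G n).
Proof.
have imp (x y : G) : dist_le n x y -> dist_le n y x.
  move/dist_leP => [p [sp pp lp]]; apply/dist_leP; exists (rev (belast x p)).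
  rewrite size_rev size_belast -lp; split => //.
    by rewrite rev_path; apply: sub_path pp => u v; rewrite sedge_sym.
  by case: p {sp pp lp} => //= z p; rewrite rev_cons last_rcons.
by move=> x y; apply/idP/idP; exact: imp.
Qed.

Section Square.
Variable G : sgraph.

Definition square_rel : rel G := fun x y => (x != y) && dist_le 2 x y.

Lemma square_sym : symmetric square_rel.
Proof. by move=> x y; rewrite /square_rel eq_sym dist_le_sym. Qed.

Lemma square_irrefl : irreflexive square_rel.
Proof. by move=> x; rewrite /square_rel eqxx. Qed.

Definition square : sgraph := SGraph square_sym square_irrefl.
End Square.

Section EdgeList.
Variables (n : nat) (s : seq (nat * nat)).

Definition edge_list_rel : rel 'I_n :=
  fun i j => (i != j) &&
    (((i : nat, j : nat) \in s) || ((j : nat, i : nat) \in s)).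

Lemma edge_list_sym : symmetric edge_list_rel.
Proof. by move=> i j; rewrite /edge_list_rel eq_sym orbC. Qed.

Lemma edge_list_irrefl : irreflexive edge_list_rel.
Proof. by move=> i; rewrite /edge_list_rel eqxx. Qed.

Definition edge_list_graph : sgraph := SGraph edge_list_sym edge_list_irrefl.
End EdgeList.

(* Vertices v_1, ..., v_5 are numbered 0, ..., 4. *)
Definition A4 : sgraph :=
  edge_list_graph 5 [:: (0, 1); (1, 2); (2, 3); (3, 0); (2, 4)].

(* Vertices a_1, ..., a_6, b, c are numbered 0, ..., 7. *)
Definition H4 : sgraph :=
  edge_list_graph 8
    [:: (0, 1); (1, 2); (2, 3); (3, 4); (4, 5); (5, 0); (1, 4); (3, 6); (6, 7)].

(* Main.v *)
Require Import Defs.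
From mathcomp Require Import all_boot zify.

(** Color the vertices by side.  An induced cycle c_0 ... c_{n-1} of the square, n >= 4, lifts
    to a cycle of G by inserting a common neighbour m_i between consecutive vertices
    c_i, c_{i+1} of the same color.  Since non-consecutive c_i are at distance at
    least 3, every chord of the lifted cycle joins two of the m_i, and as degrees are
    at most 3 each m_i lies on at most one chord.  A cycle of a chordal bipartite
    graph of length at least 6 has a chord cutting off a 4-cycle.  Such
    shortcuts preserve that no two consecutive vertices both carry chords; taking
    them repeatedly shows that the cycle has length at most 6, so n = 4 and the lift is a domino.  In an A4
    of the square, the fifth vertex is then the end of a pendant path of length 2
    at a corner of this domino, which gives an H4. *)

Set Implicit Arguments.
Unset Strict Implicit.
Unset Printing Implicit Defensive.

(* [lia] splits on every boolean atom it can see; here they are opaque naturals. *)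
Ltac count_lia :=
  rewrite /=;
  repeat match goal with |- context [nat_of_bool ?b] =>
    lazymatch b with true => change (nat_of_bool b) with 1
      | _ => generalize (nat_of_bool b) end end;
  clear; lia.

(** * Cyclic sequences, colors along paths, indices modulo [n] *)

Section Cycles.

Variable T : eqType.
Implicit Types (e : rel T) (s : seq T).

Lemma cycle_nth x0 e s i : cycle e s -> i < size s ->
  e (nth x0 s i) (nth x0 s (i.+1 %% size s)).
Proof.
case: s => // x p /= /(pathP x0) + lt_ip.
rewrite size_rcons => /(_ i lt_ip).
rewrite -rcons_cons nth_rcons /= lt_ip => He.
have [lt_i|le_i] := ltnP i (size p).
  by move: He; rewrite nth_rcons lt_i modn_small.
have -> : i = size p by lia.
move: He; have -> : i = size p by lia.
by rewrite modnn nth_rcons ltnn eqxx.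
Qed.

Lemma count_le_size_cover (a : pred T) s t : uniq s ->
  {in s, forall x, a x -> x \in t} -> count a s <= size t.
Proof.
move=> Us st; rewrite -size_filter; apply: uniq_leq_size; first exact: filter_uniq.
by move=> x; rewrite mem_filter => /andP[ax xs]; apply: st.
Qed.

End Cycles.

Lemma path_odd_color (G : sgraph) (col : G -> bool) x p :
  (forall x y : G, sedge x y -> col x != col y) ->
  path (@sedge G) x p -> col (last x p) = col x (+) odd (size p).
Proof.
move=> colP; elim: p x => [|y p IHp] x /=; first by rewrite addbF.
by case/andP=> /colP xy /IHp ->; move: xy; case: (col x) (col y) (odd _) => [] [] [].
Qed.

(** Indexing by all naturals modulo [n] lets successors be taken without treating the wraparound
    separately. *)
Lemma cyclic_extension (G : sgraph) n (f : 'I_n -> G) (e : rel G) : 1 < n ->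
  injective f -> (forall i j, e (f i) (f j) = cycle_rel i j) ->
  exists c : nat -> G, [/\ forall i : 'I_n, c i = f i,
    forall i, c (i %% n) = c i, forall i j, c i = c j -> i = j %[mod n],
    forall i, e (c i) (c i.+1) &
    forall i j, e (c i) (c j) -> j = i.+1 %[mod n] \/ i = j.+1 %[mod n]].
Proof.
move=> n1 f_inj fE; have n0 : 0 < n by exact: ltnW.
have modS i : (i %% n).+1 = i.+1 %[mod n] by rewrite -addn1 modnDml addn1.
exists (fun i => f (Ordinal (ltn_pmod i n0))); split.
- by move=> i; congr (f _); apply: val_inj; rewrite /= modn_small.
- by move=> i; congr (f _); apply: val_inj; rewrite /= modn_mod.
- by move=> i j /f_inj[].
- move=> i; rewrite fE /cycle_rel -val_eqE /= modS eqxx andbT.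
  by rewrite -{1}[i]addn0 -addn1 eqn_modDl mod0n modn_small.
- move=> i j; rewrite fE /cycle_rel /= !modS => /andP[_].
  by case/orP=> /eqP; [left|right].
Qed.

(** * Chords of cycles in a chordal bipartite graph *)

Section ChordalBipartite.

Variables (G : sgraph) (col : G -> bool).
Hypothesis colP : forall x y : G, sedge x y -> col x != col y.
Hypothesis no_long_hole : forall k, 3 <= k -> is_free (cycle_graph (2 * k)) G.

Local Notation E := (@sedge G).

Lemma sedge_col x y : col x = col y -> E x y = false.
Proof. by move=> xy; apply/negP => /colP; rewrite xy eqxx. Qed.

Lemma cycle_even s : cycle E s -> ~~ odd (size s).
Proof.
case: s => // x p /= /(path_odd_color colP).
by rewrite last_rcons size_rcons /=; case: (col x) (odd _) => [] [].
Qed.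

(** The length is even, hence at least 6, so a chordless cycle would be a forbidden induced one. The
    disjunction rules out the closing edge. *)
Lemma cycle_chord x0 s : uniq s -> cycle E s -> 5 <= size s ->
  exists i j, [/\ i.+1 < j, j < size s, (i != 0) || (j.+1 != size s)
    & E (nth x0 s i) (nth x0 s j)].
Proof.
move=> Us Cs s5; set n := size s in s5 *.
have [/existsP[i /existsP[j /and3P[]]]|] := boolP
  [exists i : 'I_n, exists j : 'I_n, [&& i.+1 < j, (i != 0 :> nat) || (j.+1 != n)
    & E (nth x0 s i) (nth x0 s j)]].
  by move=> *; exists i, j.
move=> /existsPn noch; exfalso.
have n2 : n = 2 * n./2.
  by rewrite mul2n -[LHS]odd_double_half (negbTE (cycle_even Cs)).
have k3 : 3 <= n./2 by lia.
apply: (no_long_hole k3); rewrite -n2.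
exists (fun i : 'I_n => nth x0 s i).
  by move=> i j /eqP; rewrite nth_uniq // => /eqP/val_inj.
have lt_case (i j : 'I_n) : i < j -> E (nth x0 s i) (nth x0 s j) = cycle_rel i j.
  move=> lt_ij; rewrite /cycle_rel.
  have -> : i != j by apply/eqP => ij; move: lt_ij; rewrite ij ltnn.
  rewrite [i.+1 %% n]modn_small /=; last by apply: leq_ltn_trans lt_ij _.
  have [ji|ji] /= := eqVneq (j : nat) i.+1.
    by have := cycle_nth x0 Cs (ltn_ord i); rewrite modn_small -/n -ji.
  have ji' : i.+1 < j by lia.
  have := noch i => /existsPn /(_ j); rewrite ji' /= negb_and negb_or !negbK.
  case/orP => [/andP[/eqP i0 /eqP jn]|Enot].
    have := cycle_nth x0 Cs (ltn_ord j); rewrite -/n jn modnn i0 eqxx.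
    by rewrite sedge_sym.
  rewrite (negbTE Enot); apply/esym/eqP => ij; case/negP: Enot.
  have := cycle_nth x0 Cs (ltn_ord j); rewrite -/n.
  by rewrite -ij sedge_sym.
move=> i j; case: (ltngtP i j) => [|lt_ji|/val_inj ->]; first exact: lt_case.
  by rewrite sedge_sym lt_case // [RHS]cycle_sym.
by rewrite !sedge_irrefl.
Qed.

(* The closing edge of the cycle is not among the three path edges found here:
   this is what lets the induction descend into the arc cut off by a chord. *)
Lemma cycle_short_chord s : uniq s -> cycle E s -> 4 <= size s ->
  exists l x u v y r, s = l ++ [:: x, u, v, y & r] /\ E x y.
Proof.
have [N] := ubnP (size s); elim: N => // N IHN in s * => ltN Us Cs s4.
have [s5|] := ltnP 4 (size s); last first.
  (* In a cycle of length 4 the closing edge itself serves as [E x y]. *)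
  case: s ltN Us Cs s4 => // x [|u [|v [|y [|? ?]]]] //= _ _.
  case/and5P=> _ _ _ yx _ _ _; exists [::], x, u, v, y, [::]; split=> //.
  by rewrite sedge_sym.
have x0 : G by case: s s5 {ltN Us Cs s4}.
have [i [j [lt_ij lt_js nend Eij]]] := cycle_chord x0 Us Cs s5.
(* [t] is the arc from [i] to [j], closed into a cycle by the chord. *)
pose t := take (j - i).+1 (drop i s).
have st : s = take i s ++ t ++ drop (j - i).+1 (drop i s).
  by rewrite !cat_take_drop.
have szt : size t = (j - i).+1 by rewrite size_takel // size_drop; lia.
have t0 k : k <= j - i -> nth x0 t k = nth x0 s (i + k).
  by move=> lek; rewrite nth_take // nth_drop.
have Ut : uniq t by rewrite take_uniq // drop_uniq.
have Ct : cycle E t.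
  rewrite (cycle_path x0) (last_nth x0) szt /=.
  apply/(pathP x0) => -[|k]; rewrite szt => ltk.
    by rewrite /= !t0 // addn0 subnKC 1?sedge_sym //; lia.
  rewrite /= !t0; [|lia..].
  have := cycle_nth x0 Cs (i := i + k); rewrite addnS modn_small; last lia.
  by apply; lia.
(* The arc has at least 3 vertices; evenness gives the 4 that the induction needs. *)
have ct := cycle_even Ct.
have [||l [x [u [v [y [r [tE xy]]]]]]] := IHN t _ Ut Ct.
- by move: nend; lia.
- by move: ct; rewrite szt; lia.
exists (take i s ++ l), x, u, v, y, (r ++ drop (j - i).+1 (drop i s)).
by split=> //; rewrite {1}st tE -!catA.
Qed.

(** * Degree at most 3: cycles on which every edge has a chordless end *)

Hypothesis deg3 : forall x : G, degree x <= 3.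

Lemma count_sedge_le3 x s : uniq s -> count (E x) s <= 3.
Proof.
move=> Us; apply: leq_trans (deg3 x); rewrite /degree cardE.
by apply: count_le_size_cover => // y _ xy; rewrite mem_enum inE.
Qed.

(* On a cycle [s] every vertex has two neighbours in [s], so a count below 3 says that
   the vertex carries no chord. *)
Definition light_edge s x y :=
  E x y && ((count (E x) s < 3) || (count (E y) s < 3)).

Lemma light_edge_sub s x y : light_edge s x y -> E x y.
Proof. by case/andP. Qed.

Lemma light_cycle_sub s t : cycle (light_edge s) t -> cycle E t.
Proof. by apply: sub_cycle => x y /light_edge_sub. Qed.

Lemma short_chord_rot s : uniq s -> cycle (light_edge s) s -> 4 <= size s ->
  exists x u v y r, [/\ perm_eq [:: x, u, v, y & r] s,
    cycle (light_edge [:: x, u, v, y & r]) [:: x, u, v, y & r] & E x y].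
Proof.
move=> Us Cs s4.
have [l [x [u [v [y [r [sE xy]]]]]]] := cycle_short_chord Us (light_cycle_sub Cs) s4.
exists x, u, v, y, (r ++ l).
have ps : perm_eq [:: x, u, v, y & r ++ l] s.
  by rewrite sE perm_sym perm_catC.
split=> //; rewrite (_ : [:: x, u, v, y & r ++ l] = rot (size l) s) in ps *; last first.
  by rewrite sE rot_size_cat.
rewrite rot_cycle; apply: sub_cycle Cs => a b.
by rewrite /light_edge !(permP ps).
Qed.

(** Besides [u] and [y], [x] is adjacent to its predecessor on the cycle, which is not [y] because
    [r] is nonempty; similarly for [y]. *)
Lemma short_chord_heavy s x u v y r : perm_eq [:: x, u, v, y & r] s ->
  cycle E [:: x, u, v, y & r] -> E x y -> 4 < size s ->
  2 < count (E x) s /\ 2 < count (E y) s.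
Proof.
move=> ps; rewrite -(perm_size ps) -!(permP ps).
case: r {ps} => // w r /=; rewrite rcons_path.
case/and5P=> xu uv vy yw /andP[_ zx] xy _.
have : 0 < count (E x) (w :: r).
  by rewrite -has_count; apply/hasP; exists (last w r); rewrite ?mem_last // sedge_sym.
have yv : E y v by rewrite sedge_sym.
have yx : E y x by rewrite sedge_sym.
by rewrite /= xu xy yw yv yx => w_gt0; split; move: w_gt0; count_lia.
Qed.

(* Cutting the short chord [x y] removes [u] and [v] from the cycle and leaves
   [x] and [y] without any further chord, so the hypothesis is inherited; a second
   short chord would then join the outer neighbours of [x] and [y]. *)
Lemma light_cycle_size s : uniq s -> cycle (light_edge s) s -> size s <= 6.
Proof.
have [N] := ubnP (size s); elim: N => // N IHN in s * => ltN Us Cs.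
rewrite leqNgt; apply/negP => s7.
have [|x [u [v [y [r [ps Ct xy]]]]]] := short_chord_rot Us Cs; first by lia.
rewrite -(perm_uniq ps) in Us.
rewrite -(perm_size ps) in ltN s7; set t := [:: x, u, v, y & r] in Ct Us.
have := Ct; rewrite /t /= -/t => /and4P[/light_edge_sub xu _ /light_edge_sub vy yr].
have := Us; rewrite /t /= !inE !negb_or => /and5P[/and4P[nxu nxv nxy nxr]].
move=> /and3P[nuv nuy nur] /andP[nvy nvr] nyr Ur.
have U' : uniq [:: x, y & r] by rewrite /= !inE negb_or nxy nxr nyr.
have C' : cycle (light_edge [:: x, y & r]) [:: x, y & r].
  (* [u] uses up one of the three neighbours of [x] and is absent from the shortened cycle. *)
  have cx : count (E x) [:: x, y & r] < 3.
    by have := count_sedge_le3 x Us; rewrite /t /= xu; count_lia.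
  rewrite /= {1}/light_edge xy cx /=.
  apply: sub_path yr => a b /andP[ab light].
  rewrite /light_edge ab; move: light; rewrite /t; count_lia.
have s'6 : size [:: x, y & r] <= 6 by apply: IHN => //; move: ltN; clear => /=; lia.
have ev := cycle_even (light_cycle_sub C').
have [|i [j [ij js nend Eij]]] := cycle_chord x U' (light_cycle_sub C').
  by move: s7; clear => /=; lia.
(* The shortened cycle has even length, at least 5 and at most 6, so it is a hexagon
   [x y a b c d]. *)
case: r => [|a [|b [|c [|d [|? ?]]]]] // in ev ij js nend Eij s7 s'6 t yr Ct
  Us nxr nur nvr nyr Ur U' C' ps ltN *.
have := light_cycle_sub Ct; rewrite /t /= => /and5P[_ _ _ ya /and5P[ab bc cd dx _]].
have c3 z := count_sedge_le3 z Us.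
have := Ct; rewrite /t /= => /and5P[_ _ _ /andP[_ light] _].
have yx : E y x by rewrite sedge_sym.
have xd : E x d by rewrite sedge_sym.
have yv : E y v by rewrite sedge_sym.
have ay : E a y by rewrite sedge_sym.
have dc : E d c by rewrite sedge_sym.
(* The colors leave only the three long diagonals; [x] and [y] already have three neighbours
   each. *)
have no_xb : E x b = false.
  by apply/negP => xb; have := c3 x; rewrite /t /= xu xy xb xd; count_lia.
have no_yc : E y c = false.
  by apply/negP => yc; have := c3 y; rewrite /t /= yx yv yc ya; count_lia.
(* The edge [y a] is light and [y] has three neighbours on the cycle, so [a] cannot have [d] as a
   third. *)
have no_ad : E a d = false.
  by apply/negP => ad; move: light; rewrite /= yx yv ya ay ab ad; count_lia.
have sc p q r' : E p q -> E q r' -> E p r' = false.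
  move=> /colP pq /colP qr; apply: sedge_col.
  by move: pq qr; case: (col p) (col q) (col r') => [] [] [].
move: ij js nend Eij; clear - no_xb no_yc no_ad sc xy yx ya ab bc cd xd dc.
case: i => [|[|[|[|[|[|i]]]]]]; case: j => [|[|[|[|[|[|j]]]]]] //= _ _ _;
by rewrite ?no_xb ?no_yc ?no_ad ?(sc _ _ _ xy ya) ?(sc _ _ _ ya ab) ?(sc _ _ _ ab bc)
  ?(sc _ _ _ bc cd) ?(sc _ _ _ xd dc) ?(sc _ _ _ yx xd).
Qed.


(** * Induced cycles of the square and their lift to [G] *)

Lemma square_relP x y : square_rel x y -> E x y \/ exists2 z, E z x & E z y.
Proof.
case/andP=> ne /dist_leP[[|z [|w [|? ?]]] [//= _]].
- by move=> _ xy; rewrite xy eqxx in ne.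
- by rewrite andbT => xz <-; left.
- by rewrite andbT => /andP[xz zw] <-; right; exists z => //; rewrite sedge_sym.
Qed.

Lemma sedge_square x y : E x y -> square_rel x y.
Proof.
move=> xy; apply/andP; split.
  by apply: contraTneq xy => ->; rewrite sedge_irrefl.
by apply/dist_leP; exists [:: y]; rewrite /= xy.
Qed.

Lemma common_nbr_square z x y : E z x -> E z y -> x != y -> square_rel x y.
Proof.
move=> zx zy xy; apply/andP; split=> //.
by apply/dist_leP; exists [:: z; y]; rewrite /= sedge_sym zx zy.
Qed.

Section SquareCycle.

Variables (n : nat) (c : nat -> G).
Hypothesis n_ge4 : 4 <= n.
Hypothesis c_mod : forall i, c (i %% n) = c i.
Hypothesis c_inj : forall i j, c i = c j -> i = j %[mod n].
Hypothesis c_step : forall i, square_rel (c i) (c i.+1).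
Hypothesis c_near : forall i j, square_rel (c i) (c j) ->
  j = i.+1 %[mod n] \/ i = j.+1 %[mod n].

Definition mono i := col (c i) == col (c i.+1).
(** When [mono i] holds a common neighbour exists, so the default [c i] does not arise there. *)
Definition mid i := odflt (c i) [pick z | E z (c i) && E z (c i.+1)].

Lemma c_eqmod i j : i = j %[mod n] -> c i = c j.
Proof. by move=> ij; rewrite -c_mod ij c_mod. Qed.

Lemma eqmodS i j : i = j %[mod n] -> i.+1 = j.+1 %[mod n].
Proof. by move=> /eqP; rewrite -(eqn_modDr 1) !addn1 => /eqP. Qed.

Lemma eqmodSI i j : i.+1 = j.+1 %[mod n] -> i = j %[mod n].
Proof. by move=> /eqP; rewrite -[i.+1]addn1 -[j.+1]addn1 eqn_modDr => /eqP. Qed.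

Lemma neqmod_shift i k : 0 < k < 4 -> i <> i + k %[mod n].
Proof.
move=> k4 /eqP; rewrite -{1}[i]addn0 eqn_modDl mod0n modn_small; last by lia.
by case: k k4.
Qed.

Lemma mono_eqmod i j : i = j %[mod n] -> mono i = mono j.
Proof. by move=> ij; rewrite /mono (c_eqmod ij) (c_eqmod (eqmodS ij)). Qed.

Lemma mid_eqmod i j : i = j %[mod n] -> mid i = mid j.
Proof. by move=> ij; rewrite /mid (c_eqmod ij) (c_eqmod (eqmodS ij)). Qed.

Lemma mid_sedge i : mono i -> E (mid i) (c i) /\ E (mid i) (c i.+1).
Proof.
move=> /eqP mi; rewrite /mid; case: pickP => [z /andP //|no_z].
have [/colP|[z zi zi1]] := square_relP (c_step i); first by rewrite mi eqxx.
by have := no_z z; rewrite zi zi1.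
Qed.

Lemma not_mono_sedge i : ~~ mono i -> E (c i) (c i.+1).
Proof.
have [//|[z /colP + /colP]] := square_relP (c_step i).
by rewrite /mono; case: (col z) (col (c i)) (col (c i.+1)) => [] [] [].
Qed.

Lemma common_nbr_near z i j : E z (c i) -> E z (c j) ->
  [\/ i = j %[mod n], j = i.+1 %[mod n] | i = j.+1 %[mod n]].
Proof.
move=> zi zj; have [/c_inj|ne] := eqVneq (c i) (c j); first by constructor 1.
have [|] := c_near (common_nbr_square zi zj ne); first by constructor 2.
by constructor 3.
Qed.

(** Otherwise three cycle vertices would share a neighbour and form a triangle in the square,
    impossible in an induced cycle of length at least 4. *)
Lemma consecutive_nbr z i j : E z (c i) -> E z (c i.+1) -> E z (c j) ->
  j = i %[mod n] \/ j = i.+1 %[mod n].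
Proof.
move=> zi zi1 zj; case: (common_nbr_near zj zi); [by left| |by right].
move=> ij; case: (common_nbr_near zj zi1); [by right|by move/eqmodSI; left|].
move=> ji; case: (@neqmod_shift i 3) => //.
by rewrite ij (eqmodS ji) addn3.
Qed.

(** Such a [c j] would form a triangle of the square with [c i] and [c i.+1]. *)
Lemma mid_neq_c i j : mono i -> mid i <> c j.
Proof.
move=> mi eqc; have [e0 e1] := mid_sedge mi; rewrite eqc in e0 e1.
have [/c_near ij /c_near ij1] := (sedge_square e0, sedge_square e1).
case: ij => ij; case: ij1 => ij1.
- by case: (@neqmod_shift i 1) => //; rewrite addn1 ij -ij1.
- case: (@neqmod_shift i 3) => //; rewrite addn3 ij.
  by rewrite (eqmodS ij1).
- case: (@neqmod_shift i 1) => //; rewrite addn1.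
  by rewrite -ij (eqmodSI ij1).
- by case: (@neqmod_shift j 1) => //; rewrite addn1 {1}ij1 (eqmodS ij).
Qed.

(** A shared midpoint makes the pairs [i, i.+1] and [j, j.+1] agree modulo [n]; agreeing crosswise
    would make [n] divide 2. *)
Lemma mid_inj i j : mono i -> mono j -> mid i = mid j -> i = j %[mod n].
Proof.
move=> /mid_sedge[i0 i1] /mid_sedge[j0 j1] ij; rewrite -ij in j0 j1.
case: (consecutive_nbr i0 i1 j0) => // ji.
case: (consecutive_nbr i0 i1 j1) => [|/eqmodSI//] ji1.
by case: (@neqmod_shift i 2) => //; rewrite addn2 -ji1 (eqmodS ji).
Qed.

(** The stretch after [c i] up to and including [c i.+1], so that concatenation repeats no
    endpoint. *)
Definition seg i := if mono i then [:: mid i; c i.+1] else [:: c i.+1].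
Definition lifted_cycle := flatten [seq seg i | i <- iota 0 n].

Lemma lifted_cycle_perm :
  perm_eq lifted_cycle
    ([seq c i.+1 | i <- iota 0 n] ++ [seq mid i | i <- iota 0 n & mono i]).
Proof.
rewrite /lifted_cycle; elim: (iota 0 n) => //= i r IHr.
rewrite {1}/seg; case: (mono i) => /=; last by rewrite perm_cons.
rewrite perm_sym -cat_cons perm_catC /= perm_cons.
by rewrite -cat1s perm_catCA /= perm_cons perm_catC perm_sym.
Qed.

Lemma mem_lifted_cycle z : reflect
  ((exists i, z = c i) \/ (exists2 i, mono i & z = mid i)) (z \in lifted_cycle).
Proof.
rewrite (perm_mem lifted_cycle_perm) mem_cat; apply: (iffP orP).
  case=> /mapP[i]; first by move=> _ ->; left; exists i.+1.
  by rewrite mem_filter => /andP[mi _] ->; right; exists i.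
have lt_mod i : i %% n < n by rewrite ltn_mod; lia.
case=> [[i ->]|[i mi ->]]; [left|right].
  apply/mapP; exists ((i + n.-1) %% n); first by rewrite mem_iota lt_mod.
  apply: c_eqmod; rewrite -addn1 modnDml -addnA.
  by rewrite addn1 prednK ?modnDr //; lia.
have eqi : i %% n = i %[mod n] by rewrite modn_mod.
apply/mapP; exists (i %% n); last by rewrite (mid_eqmod eqi).
by rewrite mem_filter (mono_eqmod eqi) mi mem_iota lt_mod.
Qed.

Lemma lifted_cycle_uniq : uniq lifted_cycle.
Proof.
have io i j : i \in iota 0 n -> j \in iota 0 n -> i = j %[mod n] -> i = j.
  by rewrite !mem_iota => ? ?; rewrite !modn_small.
rewrite (perm_uniq lifted_cycle_perm) cat_uniq; apply/and3P; split.
- rewrite map_inj_in_uniq ?iota_uniq // => i j /io ii /ii + /c_inj/eqmodSI.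
  exact.
- apply/hasPn => _ /mapP[i + ->]; rewrite mem_filter => /andP[mi _].
  by apply/negP => /mapP[j _ /mid_neq_c]; apply.
rewrite map_inj_in_uniq ?filter_uniq ?iota_uniq // => i j.
rewrite !mem_filter => /andP[mi /io ii] /andP[mj /ii +] /mid_inj; auto.
Qed.

(** Each of the two steps at [c i] contributes at most one neighbour: its midpoint if it is [mono],
    its other end if not. *)
Lemma count_sedge_c_le2 i : count (E (c i)) lifted_cycle <= 2.
Proof.
have [k ki] : exists k, k.+1 = i %[mod n].
  by exists (i + n.-1); rewrite -addnS prednK ?modnDr //; lia.
rewrite -(c_eqmod ki).
apply: (@count_le_size_cover _ _ _ [:: if mono k then mid k else c k;
   if mono k.+1 then mid k.+1 else c k.+2]); first exact: lifted_cycle_uniq.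
move=> z /mem_lifted_cycle[[j ->] kj|[j mj ->]].
  have := c_near (sedge_square kj); case=> [jk|/eqmodSI jk].
    move: kj; rewrite (c_eqmod jk) !inE.
    have [/eqP/sedge_col -> //|_] := boolP (mono k.+1).
    by rewrite eqxx orbT.
  move: kj; rewrite -(c_eqmod jk) !inE; case: ifP => [/eqP mk|_].
    by rewrite (sedge_col (esym mk)).
  by rewrite eqxx.
have [j0 j1] := mid_sedge mj; rewrite sedge_sym => /(consecutive_nbr j0 j1).
case=> [kj|/eqmodSI kj].
  by rewrite !inE (mono_eqmod kj) mj (mid_eqmod kj) eqxx orbT.
by rewrite !inE (mono_eqmod kj) mj (mid_eqmod kj) eqxx.
Qed.

(** Every edge of the lift has an end of the form [c i], which carries no chord. *)
Lemma lifted_cycle_light : cycle (light_edge lifted_cycle) lifted_cycle.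
Proof.
rewrite (cycle_path (c 0)); set e := light_edge _.
have walk k a : path e (c a) (flatten [seq seg i | i <- iota a k]) /\
    last (c a) (flatten [seq seg i | i <- iota a k]) = c (a + k).
  elim: k a => [|k IHk] a /=; first by rewrite addn0.
  have [IH1 IH2] := IHk a.+1.
  have light b : count (E (c b)) lifted_cycle < 3 by rewrite ltnS count_sedge_c_le2.
  set w := flatten _ in IH1 IH2 *.
  rewrite cat_path last_cat /seg.
  case: ifP => [/mid_sedge[e0 e1]|/negbT/not_mono_sedge e0] /=.
    by rewrite IH1 IH2 addSnnS /e /light_edge [E (c a) _]sedge_sym e0 e1 !light orbT.
  by rewrite IH1 IH2 addSnnS /e /light_edge e0 !light.
have [p lp] := walk n 0; rewrite -/lifted_cycle in p lp.
by rewrite lp add0n (@c_eqmod n 0) ?modnn ?mod0n.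
Qed.

(* An induced cycle of [square G] of length [n] lifts to a cycle of [G] whose chords join
   two midpoints; having at most six vertices, of which [n] are not midpoints, it
   can have such a chord only when [n = 4]. *)
Lemma square_cycle_domino :
  n = 4 /\ exists i j, [/\ mono i, mono j & E (mid i) (mid j)].
Proof.
have Ls := lifted_cycle_light; have Us := lifted_cycle_uniq.
have Cs := light_cycle_sub Ls.
have sz_le := light_cycle_size Us Ls.
have szE : size lifted_cycle = n + count mono (iota 0 n).
  by rewrite (perm_size lifted_cycle_perm) size_cat !size_map size_iota size_filter.
(* Two consecutive color-changing steps would make [c 1] a common neighbour of [c 0] and [c 2]. *)
have cnt1 : 0 < count mono (iota 0 n).
  rewrite -has_count; apply/hasP.
  have [m0|/not_mono_sedge m0] := boolP (mono 0).
    by exists 0; rewrite ?mem_iota //; lia.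
  have [m1|/not_mono_sedge m1] := boolP (mono 1).
    by exists 1; rewrite ?mem_iota //; lia.
  rewrite sedge_sym in m0; have ne : c 0 != c 2.
    by apply/eqP => /c_inj; apply: (@neqmod_shift 0 2).
  case: (c_near (common_nbr_square m0 m1 ne)) => [/esym|].
    by case/(@neqmod_shift 1 1).
  by case/(@neqmod_shift 0 3).
have sz_ge : 4 < size lifted_cycle by rewrite szE; apply: (leq_add n_ge4 cnt1).
have [|x [u [v [y [r [ps Ct xy]]]]]] := short_chord_rot Us Ls; first exact: ltnW.
have [hx hy] := short_chord_heavy ps (light_cycle_sub Ct) xy sz_ge.
(* Only midpoints can have three neighbours on the lift, so both ends of the short chord are
   midpoints. *)
have heavy_mid z : z \in lifted_cycle -> 2 < count (E z) lifted_cycle ->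
    exists2 i, mono i & z = mid i.
  case/mem_lifted_cycle => // -[i ->]; by rewrite ltnNge count_sedge_c_le2.
have [i mi xE] : exists2 i, mono i & x = mid i.
  by apply: heavy_mid => //; rewrite -(perm_mem ps) inE eqxx.
have [j mj yE] : exists2 i, mono i & y = mid i.
  by apply: heavy_mid => //; rewrite -(perm_mem ps) !inE eqxx !orbT.
split; last by exists i, j; rewrite -xE -yE.
have nxy : x != y by apply: contraTneq xy => ->; rewrite sedge_irrefl.
(* The [n] cycle vertices and two distinct midpoints fit into at most 6 vertices. *)
suff /leq_trans/(_ sz_le) : n + 2 <= size lifted_cycle.
  by move: n_ge4; clear; lia.
have <- : size ([seq c i.+1 | i <- iota 0 n] ++ [:: x; y]) = n + 2.
  by rewrite size_cat size_map size_iota.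
have := Us; rewrite (perm_uniq lifted_cycle_perm) cat_uniq => /andP[Uc _].
apply: uniq_leq_size.
  rewrite cat_uniq Uc /= !inE nxy /= !andbT orbF negb_or.
  by apply/andP; split; apply/negP => /mapP[k _]; rewrite ?xE ?yE => /mid_neq_c; apply.
move=> z; rewrite mem_cat !inE => /or3P[/mapP[k _ ->]|/eqP->|/eqP->].
- by apply/mem_lifted_cycle; left; exists k.+1.
- by apply/mem_lifted_cycle; right; exists i.
- by apply/mem_lifted_cycle; right; exists j.
Qed.

End SquareCycle.

(** * From the domino to [H4], and the two claims *)

(** Non-edges follow from colors or from non-adjacency in the square, except [a2 b], which would
    give [a2] a fourth neighbour. *)
Lemma domino_pendant_H4 a1 a2 a3 a4 a5 a6 v :
  E a1 a2 -> E a2 a3 -> E a3 a4 -> E a4 a5 -> E a5 a6 -> E a6 a1 -> E a2 a5 ->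
  ~~ square_rel a4 a1 -> ~~ square_rel a3 a6 -> square_rel a4 v ->
  [/\ v != a1, v != a3 & v != a6] ->
  [/\ ~~ square_rel v a1, ~~ square_rel v a3 & ~~ square_rel v a6] ->
  induced_subgraph H4 G.
Proof.
move=> e12 e23 e34 e45 e56 e61 e25 n41 n36 a4v [v1 v3 v6] [nv1 nv3 nv6].
have Esym x y : E x y -> E y x by rewrite sedge_sym.
have nE x y : ~~ square_rel x y -> E x y = false.
  by move=> nxy; apply: contraNF nxy; apply: sedge_square.
have nM z x y : ~~ square_rel x y -> x != y -> E z x -> E z y = false.
  by move=> nxy ne zx; apply: contraNF nxy => zy; exact: common_nbr_square zx zy ne.
have [a4v'|[b b4 bv]] := square_relP a4v.
  by have := nM _ _ _ nv3 v3 a4v'; rewrite (Esym _ _ e34).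
have b6 := nM _ _ _ nv6 v6 bv.
have v5 : E a5 v = false.
  by apply/negP => /(nM _ _ _ nv6 v6); rewrite e56.
have b2 : E a2 b = false.
  apply/negP => a2b.
  have : uniq [:: a1; a3; a5; b].
    rewrite /= !inE !negb_or !andbT; apply/and3P; split; first apply/and3P; try split.
    - by apply: contraNneq n41 => ->; rewrite sedge_square // Esym.
    - by apply: contraNneq n41 => ->; rewrite sedge_square // Esym.
    - by apply: contraNneq n41 => ->; rewrite sedge_square // Esym.
    - apply/andP; split; first by apply: contraNneq n36 => ->; rewrite sedge_square.
      by apply: contraNneq nv3 => ->; rewrite sedge_square // Esym.
    - by apply: contraFneq v5 => ->.
  by move/(count_sedge_le3 a2); rewrite /= (Esym _ _ e12) e23 e25 a2b.
have col2 x y z : E x y -> E y z -> col x = col z.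
  by move=> /colP + /colP; case: (col x) (col y) (col z) => [] [] [].
have c13 := col2 _ _ _ e12 e23; have c24 := col2 _ _ _ e23 e34.
have c35 := col2 _ _ _ e34 e45; have c46 := col2 _ _ _ e45 e56.
have c5b := col2 _ _ _ (Esym _ _ e45) (Esym _ _ b4).
have c4v := col2 _ _ _ (Esym _ _ b4) bv.
pose t := [:: a1; a2; a3; a4; a5; a6; b; v].
have edges : forall i j, i < j < 8 -> E (nth a1 t i) (nth a1 t j) =
    ((i, j) \in [:: (0, 1); (1, 2); (2, 3); (3, 4); (4, 5); (0, 5); (1, 4); (3, 6); (6, 7)]).
  have N x y : col x = col y -> E x y = false by exact: sedge_col.
  move=> [|[|[|[|[|[|[|[|i]]]]]]]] [|[|[|[|[|[|[|[|j]]]]]]]] //= ij;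
  rewrite ?inE /=; first
  [ by [] | exact: Esym
  | by apply: N; congruence
  | by rewrite sedge_sym nE
  | by rewrite nE
  | by rewrite sedge_sym
  | by case/andP: ij ].
have full (i j : 'I_8) : E (nth a1 t i) (nth a1 t j) = @sedge H4 i j.
  rewrite /= /edge_list_rel; case: (ltngtP i j) => [ij|ji|/val_inj ->].
  - rewrite edges ?ij //=; case: i j ij => [i lti] [j ltj] /= ij.
    rewrite -val_eqE /= neq_ltn ij /=.
    by do 8 (case: i lti ij => [|i] lti ij; first by do 8 (case: j ltj ij => [|j] ltj ij //)).
  - rewrite sedge_sym edges ?ji //=; case: i j ji => [i lti] [j ltj] /= ij.
    rewrite -val_eqE /= neq_ltn ij orbT /=.
    by do 8 (case: j ltj ij => [|j] ltj ij; first by do 8 (case: i lti ij => [|i] lti ij //)).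
  - by rewrite sedge_irrefl eqxx.
exists (fun i : H4 => nth a1 t i) => // i j ij.
(* No two vertices of [H4] have the same neighbourhood, so preserving adjacency already forces
   injectivity. *)
have row k (ltk : k < 8) : @sedge H4 i (Ordinal ltk) = @sedge H4 j (Ordinal ltk).
  by rewrite -!full ij.
move: (row 0 isT) (row 1 isT) (row 2 isT) (row 3 isT).
move: (row 4 isT) (row 5 isT) (row 6 isT) (row 7 isT).
rewrite /= /edge_list_rel -!val_eqE /=; case: i j {ij row} => [i lti] [j ltj] /=.
move=> r7 r6 r5 r4 r3 r2 r1 r0; apply: val_inj => /=.
move: lti ltj r7 r6 r5 r4 r3 r2 r1 r0; clear.
by do 8 (case: i => [|i]; first by do 8 (case: j => [|j] //)).
Qed.


Lemma square_hole_free : hole_free (square G).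
Proof.
move=> n n5 [f f_inj fE].
have [|c [_ c_mod c_inj c_step c_near]] := cyclic_extension _ f_inj fE.
  exact: leq_trans n5.
have [n4 _] := square_cycle_domino (ltnW n5) c_mod c_inj c_step c_near.
by rewrite n4 in n5.
Qed.

Lemma A4_square_H4 : induced_subgraph A4 (square G) -> induced_subgraph H4 G.
Proof.
move=> [f f_inj fE]; have sqf i j : @square_rel G (f i) (f j) = @sedge A4 i j := fE i j.
pose g i : G := f (widen_ord (isT : 4 <= 5) i).
have g_inj : injective g.
  by move=> i j /f_inj/(congr1 (@nat_of_ord _))/= ij; apply: val_inj.
have gE i j : square_rel (g i) (g j) = cycle_rel i j.
  rewrite sqf /= /edge_list_rel /cycle_rel -!val_eqE /=.
  by case: i j => [[|[|[|[|?]]]] ?] [[|[|[|[|?]]]] ?].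
have [//|c [cg c_mod c_inj c_step c_near]] := cyclic_extension _ g_inj gE.
have [_ [i [j [mi mj]]]] := square_cycle_domino (leqnn 4) c_mod c_inj c_step c_near.
have cf k (k4 : k < 4) : c k = g (Ordinal k4) by rewrite -cg.
have sq k l (k4 : k < 4) (l4 : l < 4) :
    square_rel (c k) (c l) = cycle_rel (Ordinal k4) (Ordinal l4).
  by rewrite !cf gE.
pose v : G := f ord_max.
have v_ne k : k < 4 -> v != c k.
  by move=> k4; rewrite (cf k k4) (inj_eq f_inj) -val_eqE /= eq_sym neq_ltn k4.
have vE k (k4 : k < 4) : square_rel v (c k) = (k == 2).
  rewrite (cf k k4) sqf /= /edge_list_rel -val_eqE /=.
  by case: k k4 => [|[|[|[|?]]]].
have vE' : square_rel (c 2) v by rewrite square_sym vE.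
have n20 : ~~ square_rel (c 2) (c 0) by rewrite sq.
have n13 : ~~ square_rel (c 1) (c 3) by rewrite sq.
have n31 : ~~ square_rel (c 3) (c 1) by rewrite sq.
have c4 : c 4 = c 0 by rewrite -c_mod.
have mod4 k : k = k %% 4 %[mod 4] by rewrite modn_mod.
rewrite (mid_eqmod c_mod (mod4 i)) (mid_eqmod c_mod (mod4 j)).
rewrite (mono_eqmod c_mod (mod4 i)) in mi; rewrite (mono_eqmod c_mod (mod4 j)) in mj.
have := ltn_pmod j (isT : 0 < 4); have := ltn_pmod i (isT : 0 < 4).
move: (i %% 4) (j %% 4) mi mj => {i j mod4} i j mi mj i4 j4 mij.
wlog ij : i j mi mj i4 j4 mij / i <= j.
  move=> W; have [ij|/ltnW ji] := leqP i j; first exact: (W i j).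
  by apply: (W j i) => //; rewrite sedge_sym.
have [mi0 mi1] := mid_sedge c_step mi; have [mj0 mj1] := mid_sedge c_step mj.
(* Adjacent midpoints have opposite colors, hence so do steps [i] and [j]. Steps sharing a vertex
   have one color, so [j] is opposite to [i] on the 4-cycle. *)
have cij : col (c i) != col (c j).
  move: (colP mi0) (colP mj0) (colP mij).
  by case: (col (c i)) (col (c j)) (col (mid c i)) (col (mid c j)) => [] [] [] [].
have j2 : j = i.+2.
  apply/eqP; move: cij i4 j4 ij; move: (eqP mi) (eqP mj).
  by case: i {mi mij mi0 mi1} => [|[|[|[|i]]]]; case: j {mj mj0 mj1} => [|[|[|[|j]]]] //=;
    rewrite ?c4 => e1 e2; rewrite ?e1 ?e2 ?eqxx -?e1 -?e2 ?eqxx.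
(* The two remaining steps change color, so they are edges of [G] and complete the domino. *)
have Ei : E (c i.+1) (c i.+2).
  apply: (not_mono_sedge c_step); rewrite /mono -(eqP mi) -j2; exact: cij.
have Ej : E (c j.+1) (c i).
  have cj : c j.+2 = c i by apply: (c_eqmod c_mod); rewrite j2 -[i.+4]addn4 modnDr.
  rewrite -cj; apply: (not_mono_sedge c_step).
  by rewrite /mono -(eqP mj) cj eq_sym.
have Esym x y : E x y -> E y x by rewrite sedge_sym.
subst j; clear ij cij mi mj.
(* In both positions [c 2] is a degree-2 corner of the domino; it takes the role of [a4]. *)
case: i i4 j4 mij mi0 mi1 mj0 mj1 Ei Ej => [|[|//]] _ _ mij mi0 mi1 mj0 mj1 Ei Ej.
- apply: (@domino_pendant_H4 (c 0) (mid c 0) (c 1) (c 2) (mid c 2) (c 3) v) => //;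
  by rewrite ?v_ne ?vE //; apply: Esym.
- rewrite c4 in mj1 Ej.
  apply: (@domino_pendant_H4 (c 0) (mid c 3) (c 3) (c 2) (mid c 1) (c 1) v) => //;
  by rewrite ?v_ne ?vE //; apply: Esym.
Qed.

End ChordalBipartite.

Theorem theorem12 (G : sgraph) (X Y : {set G}) :
  chordal_bipartite X Y ->
  (forall x : G, degree x <= 3) ->
  hole_free (square G) /\ (is_free H4 G -> is_free A4 (square G)).
Proof.
move=> [[_ dXY bip] no_hole] deg3; pose col (x : G) := x \in X.
have colP x y : sedge x y -> col x != col y.
  move/bip; rewrite /col => /orP[/andP[xX yY]|/andP[xY yX]].
    by rewrite xX (disjointFl dXY yY).
  by rewrite yX (disjointFl dXY xY).
split; first exact: (square_hole_free colP no_hole deg3).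
by move=> noH4 /(A4_square_H4 colP no_hole deg3).
Qed.
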